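(* For every positive integer $n$, the pegging number of the hypercube $Q_n$ is $P(Q_n) = 2^{n-1}+1$.
   Context: $Q_n$ is the Cartesian product of $n$ copies of $K_2$, i.e. the graph on binary $n$-tuples with two tuples adjacent iff they differ in exactly one coordinate. A distribution of pegs on a graph $\Gamma$ is a subset $D \subseteq V(\Gamma)$. If $u,v \in D$ are distinct adjacent vertices and $w \notin D$ is a vertex adjacent to $v$, the pegging move (jumping $u$ over $v$ into $w$) replaces $D$ by $(D\setminus\{u,v\})\cup\{w\}$. A vertex $t$ is reachable from $D$ if some finite (possibly empty) sequence of pegging moves starting from $D$ ends in a distribution containing $t$; $\mathrm{Reach}(D)$ is the set of reachable vertices. The pegging number $P(\Gamma)$ is the smallest positive integer $d$ such that every distribution of size $d$ on $\Gamma$ has reach $V(\Gamma)$. *)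

(* Defs.v *)
From mathcomp Require Import all_boot.

Set Implicit Arguments.
Unset Strict Implicit.
Unset Printing Implicit Defensive.

Record sgraph := SGraph {
  vertex : finType;
  adj : rel vertex;
  adj_sym : symmetric adj;
  adj_irrefl : irreflexive adj
}.

Section Pegging.

Variable G : sgraph.
Implicit Types (D E : {set vertex G}) (t : vertex G).

(* u jumps over v into w; u != v because adjacency is irreflexive. *)
Definition pegging_move D E : bool :=
  [exists u, exists v, exists w,
    [&& u \in D, v \in D, adj u v, w \notin D, adj v w
      & E == w |: (D :\: [set u; v])]].

Definition Reach D : {set vertex G} :=
  [set t | [exists E, connect pegging_move D E && (t \in E)]].

Definition pegging_bound (d : nat) : bool :=
  (0 < d) && [forall D : {set vertex G}, (#|D| == d) ==> (Reach D == [set: vertex G])].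

(* Beyond the number of vertices there are no distributions at all. *)
Lemma ex_pegging_bound : exists d, pegging_bound d.
Proof.
exists #|vertex G|.+1; apply/andP; split=> //; apply/forallP => D.
by apply/implyP => /eqP cardD; have := max_card D; rewrite cardD ltnn.
Qed.

Definition pegging_number : nat := ex_minn ex_pegging_bound.

End Pegging.

Section Hypercube.

Variable n : nat.

Definition hypercube_adj (x y : n.-tuple bool) : bool :=
  #|[set i | tnth x i != tnth y i]| == 1.

Lemma hypercube_adj_sym : symmetric hypercube_adj.
Proof.
by move=> x y; congr (_ == 1); apply: eq_card => i; rewrite !inE eq_sym.
Qed.

Lemma hypercube_adj_irrefl : irreflexive hypercube_adj.
Proof.
move=> x; rewrite /hypercube_adj (_ : [set i | _] = set0) ?cards0 //.
by apply/setP => i; rewrite !inE eqxx.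
Qed.

Definition hypercube : sgraph := SGraph hypercube_adj_sym hypercube_adj_irrefl.

End Hypercube.

(* Main.v *)
Require Import Defs.
From mathcomp Require Import all_boot zify.

(** The cube Q_(m+1) is the prism K_2 x Q_m. A full column of the prism can
    send one peg into any neighbouring column that is not full, at a free
    height, so pegs behave like pebbles on Q_m with at most two pebbles per
    vertex. Chung's theorem, that 2^m pebbles on Q_m reach any vertex, is proved
    for unordered multisets of moves satisfying a balance condition; a counting
    argument shows that such a multiset can always be ordered so that no vertex
    ever holds more than two pebbles. Conversely, placing a peg in each column
    of the prism at the height given by a proper 2-colouring of Q_m leaves no
    move at all. *)

Set Implicit Arguments.
Unset Strict Implicit.
Unset Printing Implicit Defensive.

Lemma sum_count_fiber (T : Type) (U : finType) (f : T -> U) (A : pred U) s :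
  \sum_(u | A u) count (fun x => f x == u) s = count (fun x => A (f x)) s.
Proof.
rewrite -sum1_count (partition_big f A) //; apply: eq_bigr => u Au.
rewrite -sum1_count; apply: eq_bigl => x.
by case: eqP => [->|_]; rewrite ?Au ?andbF.
Qed.

Lemma sum_nat_pred1 (T : finType) (A : {pred T}) t :
  t \in A -> \sum_(x in A) (x == t) = 1.
Proof.
by move=> At; rewrite (bigD1 t) //= eqxx big1 // => x /andP[_ /negPf->].
Qed.

Lemma exists_leq_sum (T : finType) (h : T -> nat) c :
  c <= \sum_x h x ->
  exists2 k : T -> nat, forall x, k x <= h x & \sum_x k x = c.
Proof.
elim: c => [|c IHc] le_c; first by exists (fun=> 0); rewrite // big1.
have [k le_kh sum_k] := IHc (ltnW le_c).
have [/existsP[x lt_x] | /existsPn ge_kh] := boolP [exists x, k x < h x].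
  exists (fun y => k y + (y == x)) => [y|].
    by case: eqP => [-> | _]; rewrite ?addn1 ?addn0.
  by rewrite big_split /= sum_k (@sum_nat_pred1 _ predT) ?addn1.
suff: \sum_x h x <= c by rewrite leqNgt le_c.
by rewrite -sum_k; apply: leq_sum => x _; rewrite leqNgt ge_kh.
Qed.

Definition pile (T : eqType) k (t : T) : T -> nat := fun x => k * (x == t).

Section Piles.

Variable T : finType.
Implicit Type p : T -> nat.

Definition pushforward (U : finType) (f : T -> U) p : U -> nat :=
  fun u => \sum_(x | f x == u) p x.

Lemma pushforward_inj (U : finType) (f : T -> U) p x :
  injective f -> pushforward f p (f x) = p x.
Proof. by move=> f_inj; apply: big_pred1 => y; rewrite /= (inj_eq f_inj). Qed.

Lemma pushforward_sum_pile (U : finType) (f : T -> U) p u :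
  pushforward f p u = \sum_x pile (p x) (f x) u.
Proof.
rewrite /pushforward big_mkcond; apply: eq_bigr => x _.
by rewrite /pile eq_sym; case: (u == f x); rewrite ?muln1 ?muln0.
Qed.

Definition odd_piles p : nat := \sum_x odd (p x).

Lemma sum_half p : 2 * (\sum_x (p x)./2) + odd_piles p = \sum_x p x.
Proof.
rewrite big_distrr /= -big_split /=; apply: eq_bigr => x _.
by rewrite addnC mul2n odd_double_half.
Qed.

Lemma odd_piles_le_sum p : odd_piles p <= \sum_x p x.
Proof. by rewrite -sum_half leq_addl. Qed.

Lemma odd_piles_le_card p : odd_piles p <= #|T|.
Proof. by rewrite -sum1_card; apply: leq_sum => x _; apply: leq_b1. Qed.

End Piles.

(** * Pebbling with unordered moves *)

Section Flow.

Variable G : sgraph.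
Implicit Types (p q r : vertex G -> nat) (s : seq (vertex G * vertex G)).
Implicit Type v : vertex G.

Definition outflow s v : nat := count (fun m => m.1 == v) s.
Definition inflow s v : nat := count (fun m => m.2 == v) s.

(* The moves of [s] need not be playable in the order of the list. *)
Definition flow_by s p q : Prop :=
  all (fun m => adj m.1 m.2) s /\
  forall v, q v + 2 * outflow s v <= p v + inflow s v.

Definition flow p q : Prop := exists s, flow_by s p q.

Lemma flow_frame p q p' q' :
  (forall v, p v + q' v <= p' v + q v) -> flow p q -> flow p' q'.
Proof.
move=> le_pq [s [adj_s sP]]; exists s; split=> // v.
by have := le_pq v; have := sP v; lia.
Qed.

Lemma flow_le p q : (forall v, q v <= p v) -> flow p q.
Proof. by move=> le_qp; exists [::]; split=> // v; rewrite muln0 !addn0. Qed.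

Lemma flow_pile0 p t : flow p (pile 0 t).
Proof. exact: flow_le. Qed.

Lemma flow_add p q p' q' :
  flow p q -> flow p' q' -> flow (fun v => p v + p' v) (fun v => q v + q' v).
Proof.
move=> [s [adj_s sP]] [s' [adj_s' sP']]; exists (s ++ s').
split=> [|v]; first by rewrite all_cat adj_s.
by have := sP v; have := sP' v; rewrite /outflow /inflow !count_cat; lia.
Qed.

Lemma flow_trans p q r : flow p q -> flow q r -> flow p r.
Proof. by move=> pq qr; apply: flow_frame (flow_add pq qr) => v; lia. Qed.

Lemma flow_sum (I : Type) (l : seq I) (p q : I -> vertex G -> nat) :
  (forall i, flow (p i) (q i)) ->
  flow (fun v => \sum_(i <- l) p i v) (fun v => \sum_(i <- l) q i v).
Proof.
move=> pq; elim: l => [|i l IHl].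
  by apply: flow_le => v; rewrite !big_nil.
by apply: flow_frame (flow_add (pq i) IHl) => v; rewrite !big_cons addnC.
Qed.

Lemma flow_move k u w : adj u w -> flow (pile (2 * k) u) (pile k w).
Proof.
move=> adj_uw; exists (nseq k (u, w)); split=> [|v].
  by rewrite all_nseq /= adj_uw orbT.
by rewrite /outflow /inflow /pile !count_nseq /= ![_ == v]eq_sym; lia.
Qed.

Lemma flow_moves (I : finType) (f g : I -> vertex G) k :
  (forall i, adj (f i) (g i)) ->
  flow (pushforward f (fun i => 2 * k i)) (pushforward g k).
Proof.
move=> adj_fg.
have := flow_sum (index_enum I) (fun i => flow_move (k i) (adj_fg i)).
by apply: flow_frame => v; rewrite !pushforward_sum_pile addnC.
Qed.

Lemma flow_by_rem s p p' q m :
  m \in s -> flow_by s p q ->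
  (forall v, p v + (v == m.2) <= p' v + 2 * (v == m.1)) ->
  flow_by (rem m s) p' q.
Proof.
move=> sm [adj_s sP] pp'; have s_perm := perm_to_rem sm; split=> [|v].
  by move: adj_s; rewrite (perm_all _ s_perm) => /andP[].
have := sP v; have := pp' v.
by rewrite /outflow /inflow !(permP s_perm) /= ![v == _]eq_sym; lia.
Qed.

(* Otherwise the vertices [v] with [p v <= 1] that are [t] or emit a move would
   form a set closed under predecessors that receives more moves than it
   emits. *)
Lemma flow_by_capped_move s p q t :
  flow_by s p q -> p t <= 1 -> p t < q t ->
  exists2 m, m \in s & (1 < p m.1) && (p m.2 <= 1).
Proof.
move=> [_ sP] pt_le1 pt_lt; apply/hasP; apply/negPn/negP => /hasPn no_move.
pose A := [set v | (p v <= 1) && ((v == t) || (0 < outflow s v))].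
have tA : t \in A by rewrite inE pt_le1 eqxx.
have closedA m : m \in s -> m.2 \in A -> m.1 \in A.
  move=> sm; rewrite !inE => /andP[pm2 _]; have := no_move m sm.
  rewrite pm2 andbT -leqNgt => -> /=; apply/orP; right.
  by rewrite -has_count; apply/hasP; exists m.
have in_le_out : \sum_(v in A) inflow s v <= \sum_(v in A) outflow s v.
  rewrite !sum_count_fiber.
  rewrite (@eq_in_count _ _ (fun m => (m.1 \in A) && (m.2 \in A))).
    by apply: sub_count => m /andP[].
  by move=> m /closedA; case: (m.2 \in A) => [->|]; rewrite ?andbF.
have out_lt_in v : v \in A -> outflow s v + (v == t) <= inflow s v.
  by have := sP v; rewrite inE; case: (eqVneq v t) => [->|_] /=; lia.
have := leq_sum (index_enum _) out_lt_in.
by rewrite big_split /= sum_nat_pred1 // addn1 ltnNge in_le_out.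
Qed.

End Flow.

Arguments flow : clear implicits.

Lemma flow_pushforward (G H : sgraph) (f : vertex G -> vertex H) p q :
  {homo f : x y / adj x y >-> adj x y} ->
  flow G p q -> flow H (pushforward f p) (pushforward f q).
Proof.
move=> f_adj [s [adj_s sP]]; exists [seq (f m.1, f m.2) | m <- s].
split=> [|w]; first by rewrite all_map; apply: sub_all adj_s => m /f_adj.
have := leq_sum (index_enum _) (fun v (_ : f v == w) => sP v).
rewrite big_split [leqRHS]big_split -big_distrr /= !sum_count_fiber.
by rewrite /outflow /inflow !count_map.
Qed.

Definition pebblable (G : sgraph) (N : nat) : Prop :=
  forall (p : vertex G -> nat) (t : vertex G),
    N <= \sum_x p x -> flow G p (pile 1 t).

(* Crossing pairs of pebbles out of a face of a prism does not change the number
   of odd piles in it: this is why odd piles are counted, and not all nonempty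
   piles as in Chung's two-pebbling property. *)
Definition odd_two_pebblable (G : sgraph) (N : nat) : Prop :=
  forall (p : vertex G -> nat) (t : vertex G),
    2 * N < \sum_x p x + odd_piles p -> flow G p (pile 2 t).

(** * Prisms *)

Section Prism.

Variable G : sgraph.

Definition prism_adj : rel (bool * vertex G) :=
  fun x y => if x.1 == y.1 then adj x.2 y.2 else x.2 == y.2.

Lemma prism_adj_sym : symmetric prism_adj.
Proof. by move=> x y; rewrite /prism_adj eq_sym adj_sym [_.2 == _]eq_sym. Qed.

Lemma prism_adj_irrefl : irreflexive prism_adj.
Proof. by move=> x; rewrite /prism_adj eqxx adj_irrefl. Qed.

Definition prism : sgraph := SGraph prism_adj_sym prism_adj_irrefl.

Lemma sum_prism b (F : vertex prism -> nat) :
  \sum_x F x = \sum_y F (b, y) + \sum_y F (~~ b, y).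
Proof.
rewrite -(eq_bigr _ (fun x _ => congr1 F (esym (surjective_pairing x)))).
rewrite -(pair_bigA _ (fun c y => F (c, y))) big_bool.
by case: b; rewrite // addnC.
Qed.

Lemma card_prism : #|vertex prism| = 2 * #|vertex G|.
Proof. by rewrite card_prod card_bool. Qed.

Lemma pushforward_face b c (p : vertex G -> nat) y :
  pushforward (pair b) p ((c, y) : vertex prism) = if c == b then p y else 0.
Proof.
have [->|c_neq_b] := eqVneq c b; first by apply: pushforward_inj => ? ? [].
by apply: big_pred0 => x; rewrite xpair_eqE eq_sym (negPf c_neq_b).
Qed.

Lemma flow_face b p q :
  flow G p q -> flow prism (pushforward (pair b) p) (pushforward (pair b) q).
Proof. by apply: flow_pushforward => x y; rewrite /= /prism_adj eqxx. Qed.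

Lemma prism_adj_cross b y : prism_adj (~~ b, y) (b, y).
Proof. by rewrite /prism_adj eqxx; case: b. Qed.

Lemma flow_prism (p : vertex prism -> nat) b a i j :
  flow G (fun y => p (b, y)) (pile i a) ->
  flow G (fun y => p (~~ b, y)) (pile (2 * j) a) ->
  flow prism p (pile (i + j) (b, a)).
Proof.
move=> /(flow_face b) near /(flow_face (~~ b)) far.
have cross := @flow_move prism j _ _ (prism_adj_cross b a).
apply: flow_frame (flow_add (flow_add near far) cross) => -[c y] /=.
rewrite !pushforward_face /pile !xpair_eqE.
by case: b c {near far cross} => [] [] /=; lia.
Qed.

Lemma flow_prism_cross (p : vertex prism -> nat) b a k i j :
  (forall y, 2 * k y <= p (~~ b, y)) ->
  flow G (fun y => p (b, y) + k y) (pile i a) ->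
  flow G (fun y => p (~~ b, y) - 2 * k y) (pile (2 * j) a) ->
  flow prism p (pile (i + j) (b, a)).
Proof.
move=> le_k near far.
pose q (x : vertex prism) :=
  if x.1 == b then p x + k x.2 else p x - 2 * k x.2.
have cross := @flow_moves prism _ _ _ k (prism_adj_cross b).
suff pq : flow prism p q.
  apply: flow_trans pq _; apply: flow_prism; rewrite /q /= ?eqxx //.
  by case: (b) far.
apply: flow_frame cross => -[c y]; rewrite !pushforward_face /q /=.
by have := le_k y; case: (b) c => [] [] /=; lia.
Qed.

Lemma pebblable_prism N :
  pebblable G N -> odd_two_pebblable G N -> pebblable prism (2 * N).
Proof.
move=> peb peb2 p [b a].
pose near y := p (b, y); pose far y := p (~~ b, y).
have -> : \sum_x p x = \sum_y near y + \sum_y far y := sum_prism b p.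
move=> le_p.
have [few | many] := ltnP (\sum_y near y) (odd_piles far).
  apply: (@flow_prism p b a 0 1); first exact: flow_pile0.
  by apply: (peb2 far); lia.
apply: (@flow_prism_cross p b a (fun y => (far y)./2) 1 0).
- by move=> y; rewrite mul2n -[leqRHS]odd_double_half leq_addl.
- apply: (peb (fun y => near y + (far y)./2)); rewrite big_split /=.
  by have := sum_half far; lia.
- exact: flow_pile0.
Qed.

Lemma odd_two_pebblable_prism N :
  #|vertex G| <= N -> pebblable G N -> odd_two_pebblable G N ->
  odd_two_pebblable prism (2 * N).
Proof.
move=> le_GN peb peb2 p [b a].
pose near y := p (b, y); pose far y := p (~~ b, y).
have -> : \sum_x p x = \sum_y near y + \sum_y far y := sum_prism b p.
have -> : odd_piles p = odd_piles near + odd_piles far := sum_prism b _.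
move=> gt_p.
have odd_far := leq_trans (odd_piles_le_card far) le_GN.
have odd_near := odd_piles_le_sum near.
have [near_two | le_near] := ltnP (2 * N) (\sum_y near y + odd_piles near).
  by apply: (@flow_prism p b a 2 0); [apply: peb2 | apply: flow_pile0].
have [near_one | lt_near] := leqP N (\sum_y near y).
  by apply: (@flow_prism p b a 1 1); [apply: peb | apply: (peb2 far); lia].
have [|k le_k sum_k] :=
    @exists_leq_sum _ (fun y => (far y)./2) (N - \sum_y near y).
  by have := sum_half far; lia.
have {}le_k y : 2 * k y <= far y by have := le_k y; lia.
apply: (@flow_prism_cross p b a k 1 1) => //.
  by apply: (peb (fun y => near y + k y)); rewrite big_split /= sum_k; lia.
apply: (peb2 (fun y => far y - 2 * k y)).
have -> : odd_piles (fun y => far y - 2 * k y) = odd_piles far.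
  by apply: eq_bigr => y _; rewrite oddB // mul2n odd_double addbF.
by rewrite sumnB // -big_distrr /= sum_k; lia.
Qed.

End Prism.

(** * Pegging *)

Section Reach.

Variable G : sgraph.
Implicit Types (D E : {set vertex G}) (t : vertex G).

Lemma Reach_refl D t : t \in D -> t \in Reach D.
Proof.
by move=> Dt; rewrite inE; apply/existsP; exists D; rewrite connect0.
Qed.

Lemma Reach_step D E t : pegging_move D E -> t \in Reach E -> t \in Reach D.
Proof.
move=> DE; rewrite !inE => /existsP[F /andP[EF Ft]]; apply/existsP; exists F.
by rewrite Ft (connect_trans (connect1 DE) EF).
Qed.

Definition independent D : Prop := {in D &, forall u v, ~~ adj u v}.

Lemma Reach_independent D : independent D -> Reach D = D.
Proof.
move=> indD; apply/setP => t; apply/idP/idP => [|]; last exact: Reach_refl.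
rewrite inE => /existsP[E /andP[/connectP[[|F s] /= DF ->] //]].
case/andP: DF => /existsP[u /existsP[v /existsP[w /and5P[Du Dv uv _ _]]]].
by have := indD u v Du Dv; rewrite uv.
Qed.

Lemma independent_lt_pegging_number D :
  independent D -> #|D| < #|vertex G| -> #|D| < pegging_number G.
Proof.
move=> indD ltDG; rewrite /pegging_number.
case: ex_minnP => d /andP[_ /forallP dP] _; rewrite ltnNge.
apply/card_geqP => -[s [uniq_s size_s sD]].
have := dP [set x in s]; rewrite cardsE (card_uniqP uniq_s) size_s eqxx /=.
rewrite Reach_independent => [/eqP sT | u v]; last first.
  by rewrite !inE => /sD Du /sD; apply: indD.
have := subset_leq_card (introT subsetP sD).
by rewrite -cardsE sT cardsT leqNgt ltDG.
Qed.

End Reach.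

Definition bipartite (G : sgraph) : Prop :=
  exists c : vertex G -> bool, {homo c : x y / adj x y >-> x != y}.

Lemma bipartite_prism G : bipartite G -> bipartite (prism G).
Proof.
case=> c c_adj; exists (fun x => x.1 (+) c x.2) => -[a x] [b y] /=.
rewrite /prism_adj /=; have [-> /c_adj | a_neq_b /eqP->] := eqVneq a b.
  by rewrite (inj_eq (@addbI b)).
by rewrite (inj_eq (@addIb (c y))).
Qed.

Section PrismReach.

Variable G : sgraph.
Implicit Type D : {set vertex (prism G)}.

Definition column D (x : vertex G) : nat :=
  ((true, x) \in D) + ((false, x) \in D).

Lemma sum_column D : \sum_x column D x = #|D|.
Proof.
rewrite -sum1_card [RHS]big_mkcond (sum_prism true) -big_split /=.
by apply: eq_bigr => x _; rewrite /column; do 2 case: (_ \in D).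
Qed.

Lemma column_jump D u w c :
  adj u w -> 1 < column D u -> (c, w) \notin D ->
  exists E : {set vertex (prism G)}, [/\ pegging_move D E, (c, w) \in E
    & forall x, column D x + (x == w) = column E x + 2 * (x == u)].
Proof.
move=> adj_uw full_u Dw; have u_neq_w : u != w.
  by apply: contraTneq adj_uw => ->; rewrite adj_irrefl.
have Du b : (b, u) \in D.
  by move: full_u; rewrite /column; case: b; do 2 case: (_ \in D).
pose E : {set vertex (prism G)} := (c, w) |: (D :\: [set (~~ c, u); (c, u)]).
exists E; split; last 1 first.
- move=> x; rewrite /column !inE !xpair_eqE.
  have [-> | x_neq_u] := eqVneq x u.
    by rewrite (negPf u_neq_w) !Du; case: (c).
  have [-> | x_neq_w] := eqVneq x w; last by rewrite !andbF /= !addn0.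
  by move: Dw; case: (c) => /negPf->; rewrite !andbF /=; case: (_ \in D).
- apply/existsP; exists (~~ c, u); apply/existsP; exists (c, u).
  apply/existsP; exists (c, w).
  by rewrite !Du Dw eqxx /= /prism_adj /= eqxx adj_uw eqxx; case: (c).
- by rewrite !inE eqxx.
Qed.

(* The pebbles of the column of the target are discarded, so that any peg
   jumping there may land on the target. *)
Lemma Reach_prism_flow D b t :
  flow G (fun x => if x == t then 0 else column D x) (pile 1 t) ->
  (b, t) \in Reach D.
Proof.
case=> s; have [n] := ubnP (size s); elim: n => // n IHn in s D *.
move=> lt_s s_flow.
have [Dt | Dt] := boolP ((b, t) \in D); first exact: Reach_refl.
have [||[u w] s_uw /= /andP[]] := flow_by_capped_move (t := t) s_flow.
- by rewrite eqxx.
- by rewrite /pile !eqxx.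
have [// | u_neq_t full_u le_w] := eqVneq u t.
have adj_uw : adj u w by case: s_flow => /allP/(_ _ s_uw).
have [c Dw c_eq_b] : exists2 c, (c, w) \notin D & w = t -> c = b.
  have [-> | w_neq_t] := eqVneq w t; first by exists b.
  move: le_w; rewrite (negPf w_neq_t) /column => le_w.
  exists (~~ ((true, w) \in D)) => [|/eqP]; last by rewrite (negPf w_neq_t).
  have [Dw | //] := boolP ((true, w) \in D).
  by move: le_w; rewrite Dw /=; case: (_ \in D).
have [E [DE Ew colE]] := column_jump adj_uw full_u Dw.
apply: Reach_step DE _.
have [w_t | w_neq_t] := eqVneq w t.
  by rewrite -(c_eq_b w_t) -w_t Reach_refl.
apply: IHn _ (flow_by_rem s_uw s_flow _).
  by rewrite size_rem //; case: (s) s_uw lt_s.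
move=> x /=; have := colE x; case: (eqVneq x t) => [-> _ | _ ->] //.
by rewrite eq_sym (negPf w_neq_t).
Qed.

Lemma pegging_number_prism_le N :
  pebblable G N -> pegging_number (prism G) <= N.+1.
Proof.
move=> peb; rewrite /pegging_number; case: ex_minnP => d _; apply.
apply/forallP => D; apply/implyP => /eqP card_D.
rewrite -subTset; apply/subsetP => -[b t] _.
have [Dt | Dt] := boolP ((b, t) \in D); first exact: Reach_refl.
apply/Reach_prism_flow/peb; rewrite (bigD1 t) //= eqxx add0n.
rewrite (eq_bigr (column D)) => [|y /negPf-> //].
have := sum_column D; rewrite (bigD1 t) //= card_D => sum_D.
have : column D t <= 1.
  by move: Dt; rewrite /column; case: (b) => /negPf->; case: (_ \in D).
by move: sum_D; lia.
Qed.

Lemma card_lt_pegging_number_prism :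
  bipartite G -> 0 < #|vertex G| -> #|vertex G| < pegging_number (prism G).
Proof.
case=> c c_adj G_gt0.
pose D : {set vertex (prism G)} := [set (c x, x) | x in vertex G].
have card_D : #|D| = #|vertex G| by apply: card_imset => x y [].
rewrite -card_D; apply: independent_lt_pegging_number.
  move=> _ _ /imsetP[x _ ->] /imsetP[y _ ->]; rewrite /= /prism_adj /=.
  have [c_xy | ] := eqVneq (c x) (c y).
    by apply/negP => /c_adj; rewrite c_xy eqxx.
  by apply: contraNneq => ->.
by rewrite card_D card_prism; lia.
Qed.

Lemma pegging_number_prism :
  bipartite G -> 0 < #|vertex G| -> pebblable G #|vertex G| ->
  pegging_number (prism G) = #|vertex G|.+1.
Proof.
move=> bipG G_gt0 pebG; apply/eqP.
by rewrite eqn_leq pegging_number_prism_le // card_lt_pegging_number_prism.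
Qed.

End PrismReach.

(** * Isomorphisms *)

Definition isomorphism (G H : sgraph) (f : vertex G -> vertex H) : Prop :=
  bijective f /\ {mono f : x y / adj x y >-> adj x y}.

Definition isomorphic (G H : sgraph) : Prop :=
  exists f : vertex G -> vertex H, isomorphism f.

Lemma isomorphic_sym G H : isomorphic G H -> isomorphic H G.
Proof.
case=> f [[g fK gK] f_adj]; exists g; split; first by exists f.
by move=> x y; rewrite -f_adj !gK.
Qed.

Lemma flow_isomorphism (G H : sgraph) (f : vertex G -> vertex H) p k t :
  isomorphism f -> flow G (p \o f) (pile k t) -> flow H p (pile k (f t)).
Proof.
case=> -[g fK gK] f_adj; have f_inj := can_inj fK.
move=> /(flow_pushforward (mono2W f_adj)); apply: flow_frame => v.
by rewrite -(gK v) !pushforward_inj // /pile (inj_eq f_inj).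
Qed.

Lemma bipartite_isomorphic G H : isomorphic G H -> bipartite G -> bipartite H.
Proof.
move=> /isomorphic_sym[g [_ g_adj]] [c c_adj]; exists (c \o g) => x y.
by rewrite -g_adj => /c_adj.
Qed.

Lemma pebblable_isomorphic G H N :
  isomorphic G H -> pebblable G N -> pebblable H N.
Proof.
case=> f f_iso peb p t; have [f_bij _] := f_iso; have [g _ gK] := f_bij.
rewrite (reindex f) => [le_p|]; last exact: onW_bij.
by rewrite -(gK t); apply: flow_isomorphism => //; apply: peb.
Qed.

Lemma odd_two_pebblable_isomorphic G H N :
  isomorphic G H -> odd_two_pebblable G N -> odd_two_pebblable H N.
Proof.
case=> f f_iso peb2 p t; have [f_bij _] := f_iso; have [g _ gK] := f_bij.
rewrite /odd_piles !(reindex f) => [lt_p||]; try exact: onW_bij.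
by rewrite -(gK t); apply: flow_isomorphism => //; apply: peb2.
Qed.

Lemma pegging_move_imset (G H : sgraph) (f : vertex G -> vertex H) D E :
  isomorphism f -> pegging_move D E -> pegging_move (f @: D) (f @: E).
Proof.
case=> -[g fK gK] f_adj; have f_inj := can_inj fK.
move=> /existsP[u /existsP[v /existsP[w]]].
case/and5P=> Du Dv adj_uv Dw /andP[adj_vw /eqP->].
apply/existsP; exists (f u); apply/existsP; exists (f v).
apply/existsP; exists (f w).
rewrite !(mem_imset _ _ f_inj) !f_adj Du Dv adj_uv Dw adj_vw /=.
apply/eqP/setP => z.
by rewrite -(gK z) !(inE, mem_imset _ _ f_inj, inj_eq f_inj).
Qed.

Lemma Reach_imset (G H : sgraph) (f : vertex G -> vertex H) D t :
  isomorphism f -> t \in Reach D -> f t \in Reach (f @: D).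
Proof.
move=> f_iso; rewrite !inE => /existsP[E /andP[/connectP[s Ds ->] Et]].
apply/existsP; exists (f @: last D s); rewrite imset_f // andbT.
apply/connectP; exists [seq f @: (F : {set _}) | F : {set vertex G} <- s].
  by apply: homo_path Ds => A B; apply: pegging_move_imset.
by rewrite last_map.
Qed.

Lemma pegging_number_isomorphic_le G H :
  isomorphic G H -> pegging_number H <= pegging_number G.
Proof.
case=> f f_iso; have [[g fK gK] _] := f_iso; rewrite /pegging_number.
case: ex_minnP => d _ d_min; case: ex_minnP => e /andP[e_gt0 /forallP eP] _.
apply: d_min; rewrite /pegging_bound e_gt0; apply/forallP => D.
apply/implyP => card_D; rewrite -subTset; apply/subsetP => t _.
have := eP (g @: D).
rewrite (card_imset _ (can_inj gK)) card_D => /eqP Reach_gD.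
have <- : f @: (g @: D) = D by rewrite -imset_comp (eq_imset _ gK) imset_id.
by rewrite -(gK t); apply: Reach_imset; rewrite ?Reach_gD.
Qed.

Lemma pegging_number_isomorphic G H :
  isomorphic G H -> pegging_number G = pegging_number H.
Proof.
move=> GH; apply/eqP; rewrite eqn_leq.
by rewrite !pegging_number_isomorphic_le //; apply: isomorphic_sym.
Qed.

(** * Hypercubes *)

Definition hypercube_cons m (x : bool * m.-tuple bool) : m.+1.-tuple bool :=
  [tuple of x.1 :: x.2].

Lemma hypercube_cons_bij m : bijective (@hypercube_cons m).
Proof.
exists (fun x => (thead x, [tuple of behead x])) => [[b x] | x].
  by congr pair; apply: val_inj.
by rewrite [RHS]tuple_eta; apply: val_inj.
Qed.

Lemma hypercube_adj_cons m :
  {mono @hypercube_cons m :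
    x y / @prism_adj (hypercube m) x y >-> hypercube_adj x y}.
Proof.
move=> [b x] [c y]; rewrite /hypercube_adj /prism_adj /hypercube_cons /=.
set v : m.+1.-tuple bool := [tuple of b :: x].
set w : m.+1.-tuple bool := [tuple of c :: y].
have -> : #|[set i | tnth v i != tnth w i]| =
          (b != c) + #|[set i | tnth x i != tnth y i]|.
  rewrite -!sum1dep_card big_mkcond big_ord_recl !tnth0.
  rewrite [in RHS]big_mkcond; congr (_ + _).
  by apply: eq_bigr => i _; rewrite !tnthS.
case: (eqVneq b c) => _; rewrite ?add0n // add1n eqSS cards_eq0.
apply/eqP/eqP => [/setP xy | ->]; last by apply/setP => i; rewrite !inE eqxx.
by apply: eq_from_tnth => i; have := xy i; rewrite !inE => /negPn/eqP.
Qed.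

Lemma hypercube_prism m : isomorphic (prism (hypercube m)) (hypercube m.+1).
Proof.
exists (@hypercube_cons m).
by split; [apply: hypercube_cons_bij | apply: hypercube_adj_cons].
Qed.

Lemma card_hypercube m : #|vertex (hypercube m)| = 2 ^ m.
Proof. by rewrite card_tuple card_bool. Qed.

Lemma bipartite_hypercube m : bipartite (hypercube m).
Proof.
elim: m => [|m IHm].
  by exists xpredT => x y; rewrite (tuple0 x) (tuple0 y) adj_irrefl.
exact: bipartite_isomorphic (hypercube_prism m) (bipartite_prism IHm).
Qed.

Lemma hypercube_pebblable m :
  pebblable (hypercube m) (2 ^ m) /\ odd_two_pebblable (hypercube m) (2 ^ m).
Proof.
elim: m => [|m [peb peb2]].
  have eq_t (x t : vertex (hypercube 0)) : x = t.
    by rewrite (tuple0 x) (tuple0 t).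
  have sum1 t (F : vertex (hypercube 0) -> nat) : \sum_x F x = F t.
    by rewrite (bigD1 t) //= big1 ?addn0 // => x; rewrite (eq_t x t) eqxx.
  split=> p t; rewrite /odd_piles !(sum1 t) => le_p; apply: flow_le => x.
    by rewrite (eq_t x t) /pile eqxx.
  by rewrite (eq_t x t) /pile eqxx; case: (p t) le_p => [|[|]].
rewrite expnS; split.
  exact/(pebblable_isomorphic (hypercube_prism m))/pebblable_prism.
apply: odd_two_pebblable_isomorphic (hypercube_prism m) _.
by apply: odd_two_pebblable_prism; rewrite ?card_hypercube.
Qed.

Theorem theorem5p1 (n : nat) (n_gt0 : 0 < n) :
  pegging_number (hypercube n) = 2 ^ (n - 1) + 1.
Proof.
case: n n_gt0 => // m _; rewrite subn1 addn1 /= -card_hypercube.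
rewrite -(pegging_number_isomorphic (hypercube_prism m)).
apply: pegging_number_prism; rewrite ?card_hypercube ?expn_gt0 //.
- exact: bipartite_hypercube.
- by have [] := hypercube_pebblable m.
Qed.
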